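(* Let $X$ be a topological space. If the Alexandroff duplicate $AD(X)$ satisfies the new star-Scheepers property ${}^{*}U_{fin}(\mathcal{O},\Omega)$, then $X$ satisfies ${}^{*}U_{fin}(\mathcal{O},\Omega)$.
   Context: The Alexandroff duplicate of $X$ is $AD(X)=X\times\{0,1\}$, where each point of $X\times\{1\}$ is isolated and basic neighbourhoods of $(x,0)$ are the sets $(U\times\{0\})\cup((U\times\{1\})\setminus\{(x,1)\})$ with $U$ a neighbourhood of $x$ in $X$. For $A\subseteq X$ and a family $\mathcal{P}$ of subsets of $X$, $St(A,\mathcal{P})=\bigcup\{B\in\mathcal{P} : A\cap B\neq\emptyset\}$. An $\omega$-cover of $X$ is an open cover $\mathcal{U}$ such that every finite $F\subseteq X$ is contained in some member of $\mathcal{U}$. A space $X$ satisfies ${}^{*}U_{fin}(\mathcal{O},\Omega)$ if for each sequence $(\mathcal{U}_n)_{n\in\mathbb{N}}$ of open covers of $X$ there are finite $\mathcal{V}_n\subseteq\mathcal{U}_n$ $(n\in\mathbb{N})$ such that $\{St(\bigcup_{m\in\mathbb{N}}(\bigcup\mathcal{V}_m),\mathcal{U}_n) : n\in\mathbb{N}\}$ is an $\omega$-cover of $X$. *)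

(* Defs.v *)
From HB Require Import structures.
From mathcomp Require Import all_boot all_classical topology.

Set Implicit Arguments.
Unset Strict Implicit.
Unset Printing Implicit Defensive.

Local Open Scope classical_set_scope.

(* An alias, so that the topology below does not clash with the product
   topology on [X * bool]. The layer X x {0} is [X `*` [set false]]. *)
Definition alexandroff_duplicate (X : Type) : Type := (X * bool)%type.

Section alexandroff_duplicate_topology.
Context {X : topologicalType}.

Local Notation AD := (alexandroff_duplicate X).

HB.instance Definition _ := Choice.on AD.

Definition ad_basic_nbhs (x : X) (U : set X) : set AD :=
  (U `*` [set false]) `|` ((U `*` [set true]) `\ (x, true)).

(* A set is open when it contains a basic neighbourhood of each of its points;
   a point (x, 1) has the basic neighbourhood {(x, 1)} and imposes no condition.
   This is a topology for every X. The sets [ad_basic_nbhs x U] form a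
   neighbourhood base at (x, 0) when X is T1 ([nbhs_ad_false]); for some X that
   are not T1 (e.g. two indiscrete points) no topology has these sets as
   neighbourhood bases. *)
Definition ad_open : set_system AD :=
  [set A | forall x, A (x, false) ->
     exists2 U, nbhs x U & ad_basic_nbhs x U `<=` A].

Let ad_openT : ad_open setT.
Proof. by move=> x _; exists setT => //; exact: filterT. Qed.

Let ad_openI : setI_closed ad_open.
Proof.
move=> A B oA oB x [/oA[U xU UA] /oB[V xV VB]].
exists (U `&` V); first exact: filterI.
move=> q [[[Uq Vq] q2]|[[[Uq Vq] q2] qx]]; split.
- by apply: UA; left.
- by apply: VB; left.
- by apply: UA; right.
- by apply: VB; right.
Qed.

Let ad_open_bigU (I : Type) (f : I -> set AD) :
  (forall i, ad_open (f i)) -> ad_open (\bigcup_i f i).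
Proof.
move=> of_ x [i _ /of_[U xU Uf]]; exists U => // q /Uf fq; by exists i.
Qed.

HB.instance Definition _ :=
  isOpenTopological.Build AD ad_openT ad_openI ad_open_bigU.

Lemma open_ad_true (x : X) : open [set ((x, true) : AD)].
Proof. by move=> y []. Qed.

Lemma nbhs_ad_false (x : X) : accessible_space X ->
  nbhs ((x, false) : AD) = filter_from (nbhs x) (ad_basic_nbhs x).
Proof.
move=> T1; apply/seteqP; split=> A.
  rewrite (@nbhsE AD) => -[B [oB Bx] BA]; have [U xU UB] := oB _ Bx.
  by exists U => // q /UB /BA.
case=> U; rewrite nbhsE => -[V [oV Vx] VU] UA; rewrite (@nbhsE AD).
exists (ad_basic_nbhs x V); last first.
  move=> q [[Vq q2]|[[Vq q2] qx]]; apply: UA.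
    by left; split => //; exact: VU.
  by right; split => //; split => //; exact: VU.
split; last by left.
move=> y [[/= Vy _]|[[]//]].
have [->|/eqP yx] := pselect (y = x).
  by exists V => //; exact: open_nbhs_nbhs.
exists (V `&` ~` [set x]).
  apply: open_nbhs_nbhs; split; last by split => //; exact/eqP.
  apply: openI => //; apply: closed_openC; exact: accessible_closed_set1.
move=> [z b] [[[/= Vz zx] /= bE]|[[[/= Vz zx] /= bE] _]]; subst b.
  by left.
by right; split => //= -[].
Qed.

End alexandroff_duplicate_topology.

Definition star (X : Type) (A : set X) (P : set_system X) : set X :=
  \bigcup_(B in [set B | P B /\ A `&` B !=set0]) B.

Definition open_cover (X : topologicalType) (C : set_system X) : Prop :=
  C `<=` open /\ \bigcup_(U in C) U = [set: X].

Definition omega_cover (X : topologicalType) (C : set_system X) : Prop :=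
  open_cover C /\
  forall F : set X, finite_set F -> exists2 U, C U & F `<=` U.

(* The new star-Scheepers property *U_fin(O, Omega). *)
Definition star_Ufin_O_Omega (X : topologicalType) : Prop :=
  forall U_ : nat -> set_system X, (forall n, open_cover (U_ n)) ->
  exists V_ : nat -> set_system X,
    (forall n, finite_set (V_ n) /\ V_ n `<=` U_ n) /\
    omega_cover
      (range (fun n => star (\bigcup_m \bigcup_(B in V_ m) B) (U_ n))).

(* Main.v *)
(* The projection AD(X) -> X is a continuous surjection, and the property
   passes to the image of any continuous surjection f : Y -> X. Pull the covers
   of X back to Y; since f is onto, f maps St(f^-1(A), f^-1(U)) into St(A, U),
   and finite sets lift along f. *)
Require Import Defs.
From mathcomp Require Import all_boot all_classical topology.

Set Implicit Arguments.
Unset Strict Implicit.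
Unset Printing Implicit Defensive.

Local Open Scope classical_set_scope.

Lemma open_star (X : topologicalType) (A : set X) (P : set_system X) :
  P `<=` open -> open (star A P).
Proof. by move=> Pop; apply: bigcup_open => B [/Pop]. Qed.

Lemma open_cover_preimage (X Y : topologicalType) (f : Y -> X)
    (C : set_system X) :
  continuous f -> open_cover C -> open_cover (preimage f @` C).
Proof.
move=> /continuousP cf [Cop Ccov]; split.
  by move=> _ [U CU <-]; exact/cf/Cop.
apply/seteqP; split=> // y _.
have : [set: X] (f y) by [].
by rewrite -Ccov => -[U CU Ufy]; exists (f @^-1` U) => //; exists U.
Qed.

Lemma star_Ufin_O_Omega_surj (X Y : topologicalType) (f : Y -> X) :
  continuous f -> set_surj [set: Y] [set: X] f ->
  star_Ufin_O_Omega Y -> star_Ufin_O_Omega X.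
Proof.
move=> cf fsurj SY U_ Ucov.
have /choice[s sK] : forall x, exists y, f y = x.
  by move=> x; have [y _ fy] := fsurj x I; exists y.
have imK (U : set X) : f @` (f @^-1` U) = U.
  by apply: image_preimage; apply/seteqP; split=> // x _; exact: fsurj.
have [W_ [Wfin [_ Wom]]] :=
  SY _ (fun n => open_cover_preimage cf (Ucov n)).
(* Each member of [W_ n] is the preimage of a member of [U_ n], which [imK] recovers as its
   image. *)
pose V_ n := image^~ f @` W_ n.
pose S n := star (\bigcup_m \bigcup_(B in V_ m) B) (U_ n).
(* Used twice: for arbitrary finite sets, and for singletons to get that the stars cover [X]. *)
have omV (F : set X) : finite_set F -> exists n, F `<=` S n.
  move=> /(finite_image s) /Wom[_ [n _ <-] sFW]; exists n => x Fx.
  have [_ [[U UU <-] [y [[m _ [B WB By]] Ufy]]] Ufsx] :=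
    sFW (s x) (imageP s Fx).
  exists U; last by rewrite -(sK x).
  (* Since [y] lies in [B] and in the preimage of [U], the image of [B] meets [U] at [f y]. *)
  split=> //; exists (f y); split=> //.
  by exists m => //; exists (f @` B); [exists B | exists y].
exists V_; split=> [n|].
  have [finW WU] := Wfin n; split; first exact: finite_image.
  by move=> _ [B /WU[U UU <-] <-]; rewrite imK.
split; last by move=> F /omV[n Fn]; exists (S n) => //; exists n.
split; first by move=> _ [n _ <-]; apply: open_star; case: (Ucov n).
apply/seteqP; split=> // x _.
have [n xn] := omV [set x] (finite_set1 x).
by exists (S n); [exists n | exact: xn].
Qed.

(** Openness is tested only at points [(x, false)], and there the basic neighbourhood given by [U]
    projects into [U]. *)
Lemma continuous_ad_fst (X : topologicalType) :
  continuous (fst : alexandroff_duplicate X -> X).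
Proof.
apply/continuousP => U oU.
suff: ad_open (fst @^-1` U) by [].
move=> x /= Ux; exists U; first exact: open_nbhs_nbhs.
by move=> q [[]|[[]]].
Qed.

Theorem theorem4p2 (X : topologicalType) :
  star_Ufin_O_Omega (alexandroff_duplicate X) -> star_Ufin_O_Omega X.
Proof.
apply: star_Ufin_O_Omega_surj; first exact: continuous_ad_fst.
by move=> x _; exists (x, false).
Qed.
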